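(* Let $\mathfrak g$ be a restricted Lie algebra over $\mathbb F$. The space $\operatorname{Der}_{\rm res.}(\mathfrak g)/\operatorname{ad}(\mathfrak g)$ of restricted outer derivations of $\mathfrak g$ is equal to $H^1(\mathfrak g;\mathfrak g)$, where $\mathfrak g$ is a $\mathfrak g$-module by the adjoint action.
   Context: $\mathbb F$ is a field of characteristic $p>0$. Left-normed brackets: $[g_1,g_2,\dots,g_k]=[[\cdots[[g_1,g_2],g_3]\cdots],g_k]$. A restricted Lie algebra is a Lie algebra $\mathfrak g$ over $\mathbb F$ with a map $g\mapsto g^{[p]}$ such that $(\lambda g)^{[p]}=\lambda^pg^{[p]}$; $(g+h)^{[p]}=g^{[p]}+h^{[p]}+\sum\frac1{\#(g)}[g_1,\dots,g_p]$, the sum over words $(g_1,\dots,g_p)$ in the letters $g,h$ with $g_1=g$, $g_2=h$, where $\#(g)$ is the number of letters $g$ in the word; and $[g,h^{[p]}]=[g,h,\dots,h]$ ($p$ copies of $h$). A restricted derivation of $\mathfrak g$ is an $\mathbb F$-linear map $D:\mathfrak g\to\mathfrak g$ with (i) $D([g,h])=[g,D(h)]+[D(g),h]$ and (ii) $D(g^{[p]})=(\operatorname{ad}g)^{p-1}D(g)$ for all $g,h\in\mathfrak g$, where $\operatorname{ad}g(h)=[g,h]$. $\operatorname{Der}_{\rm res.}(\mathfrak g)$ is the space of restricted derivations; it contains $\operatorname{ad}(\mathfrak g)=\{\operatorname{ad}g:g\in\mathfrak g\}$. For a restricted $\mathfrak g$-module $M$ (a $\mathfrak g$-module with $g^{[p]}x=g^px$),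 let $C^0(\mathfrak g;M)=M$, $C^1(\mathfrak g;M)=\operatorname{Hom}_{\mathbb F}(\mathfrak g,M)$, $\delta^0(m)(g)=-gm$, and $\delta^1\psi=(\delta_{\rm cl.}\psi,\tilde\psi)$, where $\delta_{\rm cl.}\psi(g,h)=-g\psi(h)+h\psi(g)+\psi([g,h])$ and $\tilde\psi(g)=\psi(g^{[p]})-g^{p-1}\psi(g)$. Then $H^1(\mathfrak g;M)=\ker\delta^1/\operatorname{im}\delta^0$. Here $M=\mathfrak g$ with $g\cdot x=[g,x]$. *)

(* Defs.v *)
From HB Require Import structures.
From mathcomp Require Import all_boot all_order all_algebra.
From mathcomp Require Import generic_quotient ring_quotient.
From mathcomp Require Import boolp functions.

Set Implicit Arguments.
Unset Strict Implicit.
Unset Printing Implicit Defensive.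

Import GRing.Theory.
Local Open Scope ring_scope.

Section Hom.
Context {F : fieldType} {U V : lmodType F}.
Local Notation Hom := {linear U -> V}.

HB.instance Definition _ := gen_eqMixin Hom.
HB.instance Definition _ := gen_choiceMixin Hom.

Lemma hom_ext (f g : Hom) : f =1 g -> f = g.
Proof.
move=> /funext; case: f g => [f cf] [g cg] /= fg; subst g; congr GRing.Linear.Pack.
case: cf cg => [[fD] [fZ]] [[gD] [gZ]].
by rewrite (Prop_irrelevance fD gD) (Prop_irrelevance fZ gZ).
Qed.

Let homN (f : Hom) : Hom := \- f.
Let homD (f g : Hom) : Hom := f \+ g.
Let hom0 : Hom := \0.
Let homZ (a : F) (f : Hom) : Hom := a \*: f.

Let homDA : associative homD.
Proof. by move=> f g h; apply: hom_ext => x /=; rewrite addrA. Qed.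
Let homDC : commutative homD.
Proof. by move=> f g; apply: hom_ext => x /=; rewrite addrC. Qed.
Let hom0D : left_id hom0 homD.
Proof. by move=> f; apply: hom_ext => x /=; rewrite add0r. Qed.
Let homND : left_inverse hom0 homN homD.
Proof. by move=> f; apply: hom_ext => x /=; rewrite addNr. Qed.

HB.instance Definition _ := GRing.isZmodule.Build Hom homDA homDC hom0D homND.

Let homZA a b f : homZ a (homZ b f) = homZ (a * b) f.
Proof. by apply: hom_ext => x /=; rewrite scalerA. Qed.
Let homZ1 : left_id 1 homZ.
Proof. by move=> f; apply: hom_ext => x /=; rewrite scale1r. Qed.
Let homZDr : right_distributive homZ +%R.
Proof. by move=> a f g; apply: hom_ext => x /=; rewrite scalerDr. Qed.
Let homZDl f : {morph homZ^~ f : a b / a + b}.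
Proof. by move=> a b; apply: hom_ext => x /=; rewrite scalerDl. Qed.

HB.instance Definition _ :=
  GRing.Zmodule_isLmodule.Build F Hom homZA homZ1 homZDr homZDl.

Lemma homDE (f g : Hom) x : (f + g) x = f x + g x. Proof. by []. Qed.
Lemma homZE a (f : Hom) x : (a *: f) x = a *: f x. Proof. by []. Qed.
Lemma homOE x : (0 : Hom) x = 0. Proof. by []. Qed.
End Hom.

Section KernelImage.
Context {F : fieldType} {U V : lmodType F}.

Definition ker_pred (f : {linear U -> V}) : {pred U} := fun x => f x == 0.

Lemma ker_closed f : submod_closed (ker_pred f).
Proof.
split=> [|a x y]; rewrite !unfold_in ?linear0 // => /eqP fx /eqP fy.
by rewrite linearP fx fy scaler0 addr0.
Qed.
HB.instance Definition _ f :=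
  GRing.isSubmodClosed.Build F U (ker_pred f) (ker_closed f).

Definition im_pred (f : {linear U -> V}) : {pred V} :=
  fun y => `[< exists x, y = f x >].

Lemma im_closed f : submod_closed (im_pred f).
Proof.
split=> [|a x y]; rewrite !unfold_in.
  by apply/asboolP; exists 0; rewrite linear0.
move=> /asboolP[u ->] /asboolP[v ->]; apply/asboolP.
by exists (a *: u + v); rewrite linearP.
Qed.
HB.instance Definition _ f :=
  GRing.isSubmodClosed.Build F V (im_pred f) (im_closed f).
End KernelImage.

Definition ker {F : fieldType} {U V : lmodType F} (f : {linear U -> V}) :
  submodClosed U := ker_pred f.
Definition im {F : fieldType} {U V : lmodType F} (f : {linear U -> V}) :
  submodClosed V := im_pred f.

Section Subquotient.
Context {F : fieldType} {V : lmodType F}.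
Implicit Types Z B : submodClosed V.

Record subspace Z := Subspace { subspace_val : V; _ : subspace_val \in Z }.
HB.instance Definition _ Z := [isSub for @subspace_val Z].
HB.instance Definition _ Z := [Choice of subspace Z by <:].
HB.instance Definition _ Z := [SubChoice_isSubLmodule of subspace Z by <:].

Definition restr_pred Z B : {pred subspace Z} := fun z => val z \in B.

Lemma restr_closed Z B : submod_closed (@restr_pred Z B).
Proof.
split=> [|a x y Bx By]; rewrite -[_ \in restr_pred B]/(val _ \in B).
  by rewrite linear0 rpred0.
by rewrite linearP rpredD ?rpredZ.
Qed.
HB.instance Definition _ Z B :=
  GRing.isSubmodClosed.Build F (subspace Z) (@restr_pred Z B) (restr_closed Z B).

(* The quotient space Z / B of two subspaces B <= Z of V. *)
Definition subquot Z B of {subset B <= Z} : Type :=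
  Quotient.quot (@restr_pred Z B).

Variables (Z B : submodClosed V) (sBZ : {subset B <= Z}).
Local Notation Q := (subquot sBZ).
Implicit Types (z : subspace Z) (x y : Q).

HB.instance Definition _ := GRing.Zmodule.on Q.

Definition class_of z : Q := (\pi_(Quotient.quot (@restr_pred Z B)) z)%qT.

Lemma class_of_eq z1 z2 :
  class_of z1 = class_of z2 <-> val z1 - val z2 \in B.
Proof.
rewrite -linearB; have := Quotient.idealrBE (@restr_pred Z B) z1 z2.
by rewrite -[_ \in restr_pred B]/(val _ \in B) => ->; split=> /eqP.
Qed.

Lemma class_of_surj x : exists z, x = class_of z.
Proof.
by exists (repr (x : Quotient.quot (@restr_pred Z B))); rewrite /class_of reprK.
Qed.

Lemma class_ofD z1 z2 : class_of (z1 + z2) = class_of z1 + class_of z2.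
Proof. exact: (raddfD \pi_(Quotient.quot (@restr_pred Z B))%qT). Qed.

Let qscale (a : F) x : Q :=
  class_of (a *: repr (x : Quotient.quot (@restr_pred Z B))).

Let qscaleE a z : qscale a (class_of z) = class_of (a *: z).
Proof.
apply/class_of_eq; rewrite -linearB -scalerBr linearZ rpredZ // linearB.
by apply/class_of_eq; rewrite /class_of reprK.
Qed.

Let qscaleA a b x : qscale a (qscale b x) = qscale (a * b) x.
Proof. by have [z ->] := class_of_surj x; rewrite !qscaleE scalerA. Qed.
Let qscale1 : left_id 1 qscale.
Proof. by move=> x; have [z ->] := class_of_surj x; rewrite qscaleE scale1r. Qed.
Let qscaleDr : right_distributive qscale +%R.
Proof.
move=> a x y; have [z ->] := class_of_surj x; have [t ->] := class_of_surj y.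
by rewrite -class_ofD !qscaleE scalerDr class_ofD.
Qed.
Let qscaleDl x : {morph qscale^~ x : a b / a + b}.
Proof.
move=> a b; have [z ->] := class_of_surj x.
by rewrite !qscaleE scalerDl class_ofD.
Qed.
HB.instance Definition _ :=
  GRing.Zmodule_isLmodule.Build F Q qscaleA qscale1 qscaleDr qscaleDl.

Lemma class_of_linear : linear class_of.
Proof. by move=> a z t; rewrite class_ofD -qscaleE. Qed.
HB.instance Definition _ :=
  GRing.isLinear.Build F (subspace Z) Q *:%R class_of class_of_linear.
End Subquotient.

HB.mixin Record isLieAlgebra (F : fieldType) L of GRing.Lmodule F L := {
  lie : L -> L -> L;
  lie_linearl : forall y, linear (lie^~ y);
  lie_linearr : forall x, linear (lie x);
  liexx : forall x, lie x x = 0;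
  lie_jacobi : forall x y z,
    lie x (lie y z) + lie y (lie z x) + lie z (lie x y) = 0
}.

#[short(type="lieType")]
HB.structure Definition LieAlgebra (F : fieldType) :=
  { L of isLieAlgebra F L & GRing.Lmodule F L }.

(* left-normed bracket of a nonempty word *)
Definition lie_word {F : fieldType} {L : lieType F} (s : seq L) : L :=
  if s is x :: s' then foldl lie x s' else 0.

(* In pmapD a word in the letters x, y is a p.-tuple bool, with true for x and
   false for y. *)
HB.mixin Record isRestrictedLieAlgebra (F : fieldType) (p : nat) L
    of LieAlgebra F L := {
  pmap : L -> L;
  pmapZ : forall (a : F) x, pmap (a *: x) = a ^+ p *: pmap x;
  pmapD : forall x y, pmap (x + y) = pmap x + pmap y +
    \sum_(w : p.-tuple bool | nth false w 0 && ~~ nth true w 1)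
      (count_mem true w)%:R^-1 *: lie_word [seq if b then x else y | b <- w];
  lie_pmap : forall x y, lie x (pmap y) = lie_word (x :: nseq p y)
}.

#[short(type="restrictedLieType")]
HB.structure Definition RestrictedLieAlgebra (F : fieldType) (p : nat) :=
  { L of isRestrictedLieAlgebra F p L & LieAlgebra F L }.

Section LieTheory.
Context {F : fieldType} {L : lieType F}.
Implicit Types x y z : L.

HB.instance Definition _ x :=
  GRing.isLinear.Build F L L *:%R (lie x) (lie_linearr x).

Definition ad x : {linear L -> L} := lie x.

Lemma ad_is_linear : linear ad.
Proof. by move=> a x y; apply: hom_ext => z; apply: lie_linearl. Qed.
HB.instance Definition _ := GRing.isLinear.Build F L {linear L -> L} *:%R ad
  ad_is_linear.

Lemma lieC x y : lie x y = - lie y x.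
Proof.
have E u v w : lie (u + v) w = lie u w + lie v w.
  by have := lie_linearl w 1 u v; rewrite !scale1r.
have := liexx (x + y); rewrite E !linearD /= !liexx add0r addr0 => /eqP.
by rewrite addr_eq0 => /eqP.
Qed.

Lemma lie_leibniz x y z : lie x (lie y z) = lie (lie x y) z + lie y (lie x z).
Proof.
have /eqP := lie_jacobi x y z.
rewrite -addrA addr_eq0 => /eqP ->; rewrite opprD addrC.
by rewrite -lieC -linearN /= -lieC.
Qed.

Lemma lie_word_nseq x y n :
  lie_word (x :: nseq n y) = (-1) ^+ n *: iter n (lie y) x.
Proof.
rewrite /lie_word; elim: n => [|n IHn]; first by rewrite scale1r.
rewrite -{1}[n.+1]addn1 nseqD foldl_cat IHn /= lieC linearZ /=.
by rewrite exprS mulN1r scaleNr.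
Qed.
End LieTheory.

Lemma pchar_sign (F : fieldType) p : p \in [pchar F] -> (-1) ^+ p = -1 :> F.
Proof.
move=> charFp; rewrite -(pFrobenius_autE charFp) rmorphN1 //.
Qed.

Lemma lie_pmapl (F : fieldType) p (g : restrictedLieType F p) (x y : g) :
  p \in [pchar F] -> lie (pmap x) y = iter p (lie x) y.
Proof.
move=> charFp; rewrite lieC lie_pmap lie_word_nseq pchar_sign //.
by rewrite scaleN1r opprK.
Qed.

Record restrictedModule (F : fieldType) (p : nat) (g : restrictedLieType F p)
    (M : lmodType F) := RestrictedModule {
  act :> g -> M -> M;
  act_linearl : forall m, linear (act^~ m);
  act_linearr : forall x, linear (act x);
  act_lie : forall x y m, act (lie x y) m = act x (act y m) - act y (act x m);
  act_pmap : forall x m, act (pmap x) m = iter p (act x) m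
}.

Lemma iter_predr T (f : T -> T) n x : (0 < n)%N -> iter n f x = iter n.-1 f (f x).
Proof. by case: n => // n _; rewrite iterSr. Qed.

Section Cohomology.
Context {F : fieldType} {p : nat} {g : restrictedLieType F p} {M : lmodType F}.
Variable A : restrictedModule g M.

HB.instance Definition _ x :=
  GRing.isLinear.Build F M M *:%R (act A x) (act_linearr A x).

Definition delta0_fun (m : M) (x : g) : M := - act A x m.

Lemma delta0_fun_linear m : linear (delta0_fun m).
Proof.
by move=> a x y; rewrite /delta0_fun act_linearl opprD scalerN.
Qed.
HB.instance Definition _ m :=
  GRing.isLinear.Build F g M *:%R (delta0_fun m) (delta0_fun_linear m).

Definition delta0 (m : M) : {linear g -> M} := delta0_fun m.

Lemma delta0_linear : linear delta0.
Proof.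
move=> a m n; apply: hom_ext => x; rewrite homDE homZE /= /delta0_fun.
by rewrite linearP opprD scalerN.
Qed.
HB.instance Definition _ :=
  GRing.isLinear.Build F M {linear g -> M} *:%R delta0 delta0_linear.

Definition delta_cl (psi : {linear g -> M}) : g -> g -> M := fun x y =>
  - act A x (psi y) + act A y (psi x) + psi (lie x y).

Definition delta_tilde (psi : {linear g -> M}) : g -> M := fun x =>
  psi (pmap x) - iter p.-1 (act A x) (psi x).

Definition delta1 (psi : {linear g -> M}) : (g -> g -> M) * (g -> M) :=
  (delta_cl psi, delta_tilde psi).

Lemma iter_act_linear x n : linear (iter n (act A x)).
Proof. by elim: n => [|n IHn] a m k //=; rewrite IHn linearP. Qed.

Lemma delta1_linear : linear delta1.
Proof.
move=> a f h; congr pair.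
  apply/funext=> x; apply/funext=> y.
  rewrite [RHS]/(_ *: delta_cl f x y + delta_cl h x y) /delta_cl.
  rewrite !homDE !homZE !linearP /= !scalerDr.
  by rewrite (addrACA (a *: _)) (addrACA (a *: _ + _)).
apply/funext=> x.
rewrite [RHS]/(_ *: delta_tilde f x + delta_tilde h x) /delta_tilde.
by rewrite !homDE !homZE iter_act_linear scalerBr opprD addrACA.
Qed.
HB.instance Definition _ := GRing.isLinear.Build F {linear g -> M}
  ((g -> g -> M) * (g -> M))%type *:%R delta1 delta1_linear.

Hypothesis charFp : p \in [pchar F].

Lemma delta1_delta0 m : delta1 (delta0 m) = 0.
Proof.
have p_gt0 : (0 < p)%N by apply: prime_gt0; have /andP[] := charFp.
congr pair.
  apply/funext=> x; apply/funext=> y.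
  rewrite /delta_cl /= /delta0_fun act_lie !linearN /= opprK opprB.
  by rewrite addrA subrK subrr.
apply/funext=> x; rewrite /delta_tilde /= /delta0_fun act_pmap.
rewrite iter_predr //.
have -> n k : iter n (act A x) (- k) = - iter n (act A x) k.
  by elim: n => //= n ->; rewrite linearN.
by rewrite opprK addNr.
Qed.

Definition Z1 : submodClosed {linear g -> M} := ker delta1.
Definition B1 : submodClosed {linear g -> M} := im delta0.

Lemma B1_sub_Z1 : {subset B1 <= Z1}.
Proof.
move=> psi /asboolP[m ->]; apply/eqP; exact: delta1_delta0.
Qed.

Definition H1 : lmodType F := subquot B1_sub_Z1.

End Cohomology.

Section Derivations.
Context {F : fieldType} {p : nat} {g : restrictedLieType F p}.
Implicit Types (D : {linear g -> g}) (x y : g).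

Record is_restricted_derivation D : Prop := RestrictedDerivation {
  derivation_lie : forall x y, D (lie x y) = lie x (D y) + lie (D x) y;
  derivation_pmap : forall x, D (pmap x) = iter p.-1 (ad x) (D x)
}.

Definition der_res_pred : {pred {linear g -> g}} :=
  fun D => `[< is_restricted_derivation D >].

Lemma der_res_closed : submod_closed der_res_pred.
Proof.
split=> [|a D E].
  apply/asboolP; split=> [x y|x]; rewrite !homOE ?linear0.
    by rewrite lieC linear0 oppr0 addr0.
  by elim: p.-1 => //= n <-; rewrite linear0.
move=> /asboolP[D1 D2] /asboolP[E1 E2]; apply/asboolP; split=> [x y|x].
  rewrite !homDE !homZE D1 E1 scalerDr addrACA -linearP.
  by congr (_ + _); rewrite -lie_linearl.
rewrite !homDE !homZE D2 E2.
by elim: p.-1 => //= n <-; rewrite linearP.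
Qed.
HB.instance Definition _ :=
  GRing.isSubmodClosed.Build F {linear g -> g} der_res_pred der_res_closed.

Definition Der_res : submodClosed {linear g -> g} := der_res_pred.
Definition ad_space : submodClosed {linear g -> g} := im (@ad F g).

Hypothesis charFp : p \in [pchar F].

Lemma ad_sub_Der_res : {subset ad_space <= Der_res}.
Proof.
move=> D /asboolP[z ->]; apply/asboolP; split=> [x y|x] /=.
  by rewrite addrC lie_leibniz.
rewrite lie_pmap lie_word_nseq pchar_sign // scaleN1r.
have p_gt0 : (0 < p)%N by apply: prime_gt0; have /andP[] := charFp.
rewrite iter_predr // (lieC z x).
by elim: p.-1 => //= n <-; rewrite linearN.
Qed.

Definition Out_res : lmodType F := subquot ad_sub_Der_res.

Definition adjoint : restrictedModule g g.
Proof.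
exists (@lie F g).
- exact: lie_linearl.
- exact: lie_linearr.
- by move=> x y m; rewrite lie_leibniz addrK.
- by move=> x m; rewrite lie_pmapl.
Defined.

End Derivations.

Arguments Der_res {F p} g.
Arguments ad_space {F p} g.
Arguments Out_res {F p} g charFp.
Arguments adjoint {F p} g charFp.
Arguments class_of {F V Z B} sBZ z.
Arguments ad_sub_Der_res {F p g} charFp.
Arguments B1_sub_Z1 {F p g M A} charFp.
Arguments H1 {F p g M} A charFp.

(* Main.v *)
Require Import Defs.
From HB Require Import structures.
From mathcomp Require Import all_boot all_algebra.
From mathcomp Require Import boolp.

Set Implicit Arguments.
Unset Strict Implicit.
Unset Printing Implicit Defensive.

Import GRing.Theory.
Local Open Scope ring_scope.

(** Both quotients are formed from subspaces of the linear maps [g -> g], and these subspaces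
    coincide. For the adjoint action, [delta_cl D] vanishes exactly when [D] satisfies the Leibniz
    rule, by antisymmetry of the bracket, and [delta_tilde D] vanishes exactly when [D] respects the
    [p]-map ([Der_res_eq_Z1]). Antisymmetry also turns [delta0] into [ad] ([ad_space_eq_B1]).
    [subquot_eq_iso] then passes from equal subspaces to the quotients. *)

Section SubquotientMap.
Context {F : fieldType} {V : lmodType F} {Z B Z' B' : submodClosed V}.
Context {sBZ : {subset B <= Z}} {sBZ' : {subset B' <= Z'}}.
Variables (sZ : {subset Z <= Z'}) (sB : {subset B <= B'}).

Definition subspace_incl (z : subspace Z) : subspace Z' :=
  Subspace (sZ (valP z)).

Definition subquot_map (x : subquot sBZ) : subquot sBZ' :=
  class_of sBZ' (subspace_incl (projT1 (cid (class_of_surj x)))).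

(** The map is defined through a chosen representative. Another choice changes it by an element of
    [B], hence of [B'], so the class in the target does not change. *)
Lemma subquot_mapE (z : subspace Z) (z' : subspace Z') :
  val z = val z' -> subquot_map (class_of sBZ z) = class_of sBZ' z'.
Proof.
rewrite /subquot_map; case: cid => t /= /esym/class_of_eq tz_B eq_z.
by apply/class_of_eq; rewrite -[val z']eq_z; apply: sB.
Qed.

Lemma subquot_map_linear : linear subquot_map.
Proof.
move=> a x y; have [z ->] := class_of_surj x; have [t ->] := class_of_surj y.
rewrite -class_of_linear.
rewrite (@subquot_mapE z (subspace_incl z)) //.
rewrite (@subquot_mapE t (subspace_incl t)) // -class_of_linear.
by apply: subquot_mapE; rewrite !linearP.
Qed.
End SubquotientMap.

Lemma subquot_mapK (F : fieldType) (V : lmodType F) (Z B Z' B' : submodClosed V)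
    (sBZ : {subset B <= Z}) (sBZ' : {subset B' <= Z'})
    (sZ : {subset Z <= Z'}) (sB : {subset B <= B'})
    (sZ' : {subset Z' <= Z}) (sB' : {subset B' <= B}) :
  cancel (@subquot_map F V Z B Z' B' sBZ sBZ' sZ)
         (@subquot_map F V Z' B' Z B sBZ' sBZ sZ').
Proof.
move=> x; have [z ->] := class_of_surj x.
rewrite (subquot_mapE sZ sB (z' := subspace_incl sZ z)) //.
exact: subquot_mapE.
Qed.

(** Subspaces with the same elements may still be different terms, giving different quotient types;
    the identity on representatives is the isomorphism between them. *)
Lemma subquot_eq_iso (F : fieldType) (V : lmodType F)
    (Z B Z' B' : submodClosed V)
    (sBZ : {subset B <= Z}) (sBZ' : {subset B' <= Z'}) :
  Z =i Z' -> B =i B' ->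
  exists phi : {linear subquot sBZ -> subquot sBZ'}, bijective phi /\
    forall (z : subspace Z) (z' : subspace Z'),
      val z = val z' -> phi (class_of sBZ z) = class_of sBZ' z'.
Proof.
move=> eqZ eqB.
have sZ : {subset Z <= Z'} by move=> v; rewrite eqZ.
have sZ' : {subset Z' <= Z} by move=> v; rewrite eqZ.
have sB : {subset B <= B'} by move=> v; rewrite eqB.
have sB' : {subset B' <= B} by move=> v; rewrite eqB.
pose phi_lin := GRing.isLinear.Build F (subquot sBZ) (subquot sBZ') *:%R
  (subquot_map sZ) (subquot_map_linear sZ sB).
pose phi : {linear subquot sBZ -> subquot sBZ'} :=
  HB.pack (subquot_map (sBZ := sBZ) (sBZ' := sBZ') sZ) phi_lin.
exists phi; split; last exact: subquot_mapE.
by exists (subquot_map sZ'); apply: subquot_mapK.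
Qed.

Lemma Der_res_eq_Z1 (F : fieldType) (p : nat) (charFp : p \in [pchar F])
    (g : restrictedLieType F p) :
  Der_res g =i Z1 (adjoint g charFp).
Proof.
move=> D; apply/asboolP/eqP => [[Dlie Dpmap]|].
  (* The action of [adjoint] computes to [lie], so [Dpmap] is literally the vanishing of
     [delta_tilde]. *)
  congr pair; apply/funext=> x; last by rewrite /delta_tilde Dpmap subrr.
  apply/funext=> y.
  by rewrite /delta_cl /= Dlie (lieC (D x)) addrACA addNr subrr addr0.
move=> [/funeqP Dcl /funeqP Dtilde].
split=> [x y|x]; last by apply/eqP; rewrite -subr_eq0; apply/eqP/Dtilde.
(* Solving the cocycle identity for [D (lie x y)] gives the Leibniz rule with [- lie y (D x)] in
   place of [lie (D x) y]. *)
have /eqP := congr1 (fun f => f y) (Dcl x).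
rewrite /delta_cl /= addrC addr_eq0 opprD opprK => /eqP ->.
by rewrite -lieC.
Qed.

(** The sign in [delta0] is absorbed by antisymmetry, [- lie y x = lie x y], so the same witness [x]
    serves in both directions. *)
Lemma ad_space_eq_B1 (F : fieldType) (p : nat) (charFp : p \in [pchar F])
    (g : restrictedLieType F p) :
  ad_space g =i B1 (adjoint g charFp).
Proof.
move=> D; apply/asboolP/asboolP => -[x ->]; exists x; apply: hom_ext => y.
  exact: lieC.
by rewrite [RHS]lieC.
Qed.

Theorem theorem3p17 (F : fieldType) (p : nat) (charFp : p \in [pchar F])
    (g : restrictedLieType F p) :
  [/\ Der_res g =i Z1 (adjoint g charFp),
      ad_space g =i B1 (adjoint g charFp)
    & exists phi : {linear Out_res g charFp -> H1 (adjoint g charFp) charFp},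
        bijective phi /\
        forall (D : subspace (Der_res g))
               (psi : subspace (Z1 (adjoint g charFp))),
          val D = val psi ->
          phi (class_of (ad_sub_Der_res charFp) D)
            = class_of (B1_sub_Z1 charFp) psi].
Proof.
split; [exact: Der_res_eq_Z1 | exact: ad_space_eq_B1 |].
by apply: subquot_eq_iso; [exact: Der_res_eq_Z1 | exact: ad_space_eq_B1].
Qed.
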